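(* Assume that $r>0$ is a required exponential decay rate and that $\delta_a\in(0,1)$, $a\in\mathcal{A}$, satisfy $\sum_{a\in\mathcal{A}}\delta_a=1$. For sample sizes $T_1,\ldots,T_n\in\mathbb{Z}_{>0}$, let $T_{min}=\min_{a\in\mathcal{A}}T_a$ and $$r_a=\frac{1}{T_a}\Big(d_a\ln(T_a+1)+rT_{min}-\ln\delta_a\Big)\qquad\forall a\in\mathcal{A}.$$ Then the distributionally robust prediction rule $\hat{f}_{DR}$ with these parameters $r_a$ is feasible in the prediction problem, that is, $$\limsup_{T_{min}\to+\infty}\frac{1}{T_{min}}\ln\Big(\Pr\Big\{f(\mathbf{x},\mathbb{Q}^* )>\hat{f}_{DR}(\mathbf{x},\widehat{\mathbf{Q}}(T_1,\ldots,T_n))\Big\}\Big)\le -r\qquad\forall\mathbf{x}\in X,\ \forall\mathbb{Q}^*\in\mathcal{Q}.$$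
   Context: Let $n = n_1 + n_2$, $\mathcal{A} = \{1,\ldots,n\}$, and let $X \subseteq \mathbb{Z}^{n_1}\times\mathbb{R}^{n_2}$ be a nonempty linear mixed-integer set (the points of $\mathbb{Z}^{n_1}\times\mathbb{R}^{n_2}$ satisfying a finite system of linear constraints) such that $\mathbf{0}\notin X$ and there is $\mathbf{u}\in\mathbb{R}^n_+$ with $x_a\in[0,u_a]$ for all $a\in\mathcal{A}$ and all $\mathbf{x}\in X$. For each $a\in\mathcal{A}$, the cost $c_a$ takes values in a finite set $\mathcal{S}_a=\{z_{a,1},\ldots,z_{a,d_a}\}$ of $d_a$ strictly positive reals. $\mathcal{Q}_a$ is the set of all probability distributions on $\mathcal{S}_a$, each identified with $(q_{a,1},\ldots,q_{a,d_a})$, where $q_{a,i}$ is the probability that $c_a=z_{a,i}$. $\mathcal{Q}$ is the set of all probability distributions of $\mathbf{c}=(c_1,\ldots,c_n)^\top$ on $\mathcal{S}_1\times\cdots\times\mathcal{S}_n$; for $\mathbb{Q}\in\mathcal{Q}$, $\mathbb{Q}_a$ is its $a$-th marginal and $\mathbf{Q}=(\mathbb{Q}_1,\ldots,\mathbb{Q}_n)^\top$. The expected loss is $f(\mathbf{x},\mathbb{Q})=\mathbb{E}_{\mathbb{Q}}\{\mathbf{c}^\top\mathbf{x}\}=\sum_{a\in\mathcal{A}}\mathbb{E}_{\mathbb{Q}_a}\{c_a\}x_a$. Data: under the nominal distribution $\mathbb{Q}^*\in\mathcal{Q}$, for each $a\in\mathcal{A}$ there are $T_a$ i.i.d. samples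 $\widehat{c}_{a,1},\ldots,\widehat{c}_{a,T_a}$ from the marginal $\mathbb{Q}^*_a$; nothing is assumed about the dependence between samples of different components. $\Pr$ is the probability under the law of the data. The empirical marginal distribution $\widehat{\mathbb{Q}}_{a,T_a}$ has probabilities $\widehat{q}_{a,i}=\frac{1}{T_a}\#\{j:\widehat{c}_{a,j}=z_{a,i}\}$, and $\widehat{\mathbf{Q}}(T_1,\ldots,T_n)=(\widehat{\mathbb{Q}}_{1,T_1},\ldots,\widehat{\mathbb{Q}}_{n,T_n})^\top$. The relative entropy distance is $D_{KL}(\mathbb{P}_a\Vert\mathbb{Q}_a)=\sum_{i=1}^{d_a}p_{a,i}\ln\frac{p_{a,i}}{q_{a,i}}$, with $0\ln(0/q)=0$ for $q\ge 0$ and $q'\ln(q'/0)=\infty$ for $q'>0$. For parameters $r_a>0$ the distributionally robust prediction rule is, for $\mathbf{x}\in X$ and $\mathbf{P}=(\mathbb{P}_1,\ldots,\mathbb{P}_n)^\top\in\mathcal{Q}_1\times\cdots\times\mathcal{Q}_n$, $$\hat{f}_{DR}(\mathbf{x},\mathbf{P})=\sum_{a\in\mathcal{A}}\Big(\max\{\mathbb{E}_{\mathbb{Q}_a}\{c_a\}:\mathbb{Q}_a\in\mathcal{Q}_a,\ D_{KL}(\mathbb{P}_a\Vert\mathbb{Q}_a)\le r_a\}\Big)x_a.$$ When evaluated at data with sample sizes $T_1,\ldots,T_n$, the parameters $r_a$ are those corresponding to these sample sizes. The limit superior as $T_{min}\to+\infty$ is over all tuples $(T_1,\ldots,T_n)\in\mathbb{Z}_{>0}^n$,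 i.e. $\lim_{m\to\infty}\sup\{\cdot: \min_a T_a\ge m\}$, with $\ln 0=-\infty$. *)

(* Defs.v *)
From HB Require Import structures.
From mathcomp Require Import all_boot all_order all_algebra.
From mathcomp Require Import all_classical all_reals all_analysis.

Set Implicit Arguments.
Unset Strict Implicit.
Unset Printing Implicit Defensive.

Import Order.TTheory GRing.Theory Num.Theory.

Local Open Scope classical_set_scope.
Local Open Scope ring_scope.

(* Equations are covered by pairs of opposite inequalities. *)
Definition mixed_integer_polyhedron (R : realType) (n1 n2 m : nat)
    (A : 'M[R]_(m, n1 + n2)) (b : 'cV[R]_m) : set 'cV[R]_(n1 + n2) :=
  [set x | (forall k : 'I_m, (A *m x) k 0 <= b k 0) /\
           (forall j : 'I_n1, x (lshift n2 j) 0 \is a Num.int)].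

Definition linear_mixed_integer_set (R : realType) (n1 n2 : nat)
    (X : set 'cV[R]_(n1 + n2)) : Prop :=
  exists (m : nat) (A : 'M[R]_(m, n1 + n2)) (b : 'cV[R]_m),
    X = mixed_integer_polyhedron A b.

(* Probability distributions on a finite type, as vectors of probabilities.
   A distribution on the support S_a = {z a i | i : 'I_(d a)} is an element of
   [simplex R 'I_(d a)]; one on the product of these supports is an element of
   [simplex R {dffun forall a, 'I_(d a)}]. *)
Definition simplex (R : realType) (I : finType) : set (I -> R) :=
  [set q | (forall i, 0 <= q i) /\ \sum_i q i = 1].
Arguments simplex : clear implicits.

Definition expect (R : realType) (I : finType) (v q : I -> R) : R :=
  \sum_i q i * v i.

Definition KL (R : realType) (I : finType) (p q : I -> R) : \bar R :=
  (\sum_i (if p i == 0%R then 0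
           else if q i == 0%R then +oo
           else (p i * ln (p i / q i))%:E))%E.

(* [A `&` ubound A] contains at most one point, the largest element of [A];
   the value is the junk 0 when the maximum is not attained. *)
Definition maximum (R : realType) (A : set R) : R :=
  xget 0 (A `&` ubound A).

Section Model.
Context {R : realType} {n : nat} {d : 'I_n -> nat}.

Definition marginal (Q : {dffun forall a : 'I_n, 'I_(d a)} -> R) (a : 'I_n)
    (i : 'I_(d a)) : R :=
  \sum_(s : {dffun forall a : 'I_n, 'I_(d a)} | s a == i) Q s.

Definition expected_loss (z : forall a : 'I_n, 'I_(d a) -> R) (x : 'cV[R]_n)
    (Q : {dffun forall a : 'I_n, 'I_(d a)} -> R) : R :=
  expect (fun s : {dffun forall a : 'I_n, 'I_(d a)} =>
            \sum_a z a (s a) * x a 0) Q.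

Definition dr_rule (z : forall a : 'I_n, 'I_(d a) -> R) (rad : 'I_n -> R)
    (x : 'cV[R]_n) (p : forall a : 'I_n, 'I_(d a) -> R) : R :=
  \sum_a maximum [set expect (z a) q | q in
           simplex R 'I_(d a) `&` [set q | (KL (p a) q <= (rad a)%:E)%E]]
         * x a 0.

End Model.
Arguments marginal {R n d} Q a _.

(* The idx of the iterated minimum is an upper bound of all the [T a], so this
   is the minimum as soon as [n > 0]. *)
Definition Tmin (n : nat) (T : 'I_n -> nat) : nat :=
  (\big[minn/(\max_(a < n) T a)]_(a < n) T a)%N.

Definition kl_radius (R : realType) (n : nat) (d : 'I_n -> nat) (r : R)
    (delta : 'I_n -> R) (T : 'I_n -> nat) (a : 'I_n) : R :=
  (T a)%:R^-1 *
  ((d a)%:R * ln (T a + 1)%:R + r * (Tmin T)%:R - ln (delta a)).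

Section Data.
Context {disp : measure_display} {Omega : measurableType disp} {R : realType}.
Variable P : probability Omega R.

Definition mutually_independent (I : finType) (c : I -> {RV P >-> R}) : Prop :=
  forall (J : {set I}) (B : I -> set R), (forall j, measurable (B j)) ->
    P (\bigcap_(j in [set` J]) (c j @^-1` B j)) =
    (\prod_(j in J) P (c j @^-1` B j))%E.

Definition iid_samples (k t : nat) (v q : 'I_k -> R)
    (c : 'I_t -> {RV P >-> R}) : Prop :=
  mutually_independent c /\ forall j i, pmf (c j) (v i) = q i.

End Data.

Definition empirical (R : realType) (k t : nat) (v : 'I_k -> R)
    (c : 'I_t -> R) (i : 'I_k) : R :=
  t%:R^-1 * #|[set j : 'I_t | c j == v i]%SET|%:R.

(* limsup of g as Tmin T tends to infinity, over tuples of positive sizes. *)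
Definition limsup_Tmin (R : realType) (n : nat)
    (g : ('I_n -> nat) -> \bar R) : \bar R :=
  limn (fun m : nat => ereal_sup
    [set g T | T in [set T | (forall a, (0 < T a)%N) /\ (m <= Tmin T)%N]]).

(* Main.v *)
(* Write k for the vector of counts of a sample of size t. For a nonnegative
   vector q,
     D_KL(k / t || q) <= r  iff
     exp(-t r) * prod_i (k_i / t)^(k_i) <= prod_i q_i^(k_i).
   The right-hand side is polynomial in q, so D_KL balls intersected with the
   simplex are compact and the maxima in the prediction rule are attained.
   Moreover prod_i q_i^(k_i) is the likelihood of the sample under q, so the
   method of types gives
     Pr(D_KL(empirical || q) > r_a) <= (T_a + 1)^(d_a) exp(-T_a r_a),
   which the choice of r_a makes equal to delta_a exp(-r Tmin). If no marginal
   leaves its ball then the expected loss is at most the prediction since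
   x >= 0, and a union bound over the marginals gives exp(-r Tmin) in total, as
   the delta_a sum to 1. *)

Require Import Defs.
From HB Require Import structures.
From mathcomp Require Import all_boot all_order all_algebra.
From mathcomp Require Import all_classical all_reals all_analysis.

Import Order.TTheory GRing.Theory Num.Theory.
Import numFieldNormedType.Exports.

Local Open Scope classical_set_scope.
Local Open Scope ring_scope.

(** * Relative entropy balls in likelihood form *)

(** If [q] vanishes where [k] does not, the divergence is infinite and the likelihood is 0, so both
    sides fail. Otherwise the likelihood is exp(-t KL) times its value at [k / t], and that positive
    factor cancels. *)
Lemma KL_type_le (R : realType) (I : finType) (k : I -> nat) (t : nat)
    (q : I -> R) (r : R) :
  (0 < t)%N -> (forall i, 0 <= q i) ->
  (KL (fun i => t%:R^-1 * (k i)%:R)%R q <= r%:E)%E =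
  (expR (- (t%:R * r)) * \prod_i (t%:R^-1 * (k i)%:R) ^+ k i
   <= \prod_i q i ^+ k i).
Proof.
move=> t_gt0 q_ge0; set p := fun i => _.
have tR_gt0 : 0 < t%:R :> R by rewrite ltr0n.
have p_eq0 i : (p i == 0) = (k i == 0%N).
  by rewrite /p mulf_eq0 invr_eq0 gt_eqF //= pnatr_eq0.
have p_ge0 i : 0 <= p i by rewrite mulr_ge0 // invr_ge0 ler0n.
have prodp_gt0 : 0 < \prod_i p i ^+ k i.
  apply: prodr_gt0 => i _; have [->//|ki_neq0] := eqVneq (k i) 0%N.
  by rewrite exprn_gt0 // lt_neqAle eq_sym p_eq0 ki_neq0 p_ge0.
have [/existsP[i0 /andP[ki0 qi0]]|/existsPn q_supp] :=
    boolP [exists i, (k i != 0%N) && (q i == 0)].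
  have -> : KL p q = +oo%E.
    apply/esum_eqyP => [i _|]; first by case: ifP => //; case: ifP.
    by exists i0; rewrite mem_index_enum p_eq0 (negbTE ki0) qi0.
  rewrite [X in _ = (_ <= X)](_ : _ = 0); last first.
    by apply/eqP/prodf_eq0; exists i0; rewrite // expf_eq0 lt0n ki0 qi0.
  by rewrite leye_eq /= leNgt mulr_gt0 ?expR_gt0.
pose f i := if p i == 0 then 0 else p i * ln (p i / q i).
have -> : KL p q = (\sum_i f i)%:E.
  rewrite -sumEFin /KL; apply: eq_bigr => i _; rewrite /f.
  have := q_supp i; rewrite negb_and negbK -p_eq0.
  by case: (p i == 0) => //= /negbTE ->.
have -> : \prod_i q i ^+ k i
    = expR (- (t%:R * \sum_i f i)) * \prod_i p i ^+ k i.
  rewrite mulr_sumr -sumrN expR_sum -big_split; apply: eq_bigr => i _ /=.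
  have := q_supp i; rewrite negb_and negbK /f -p_eq0.
  have [|pi_neq0 /= qi_neq0] := eqVneq (p i) 0 => /=.
    by move/eqP; rewrite p_eq0 => /eqP -> _; rewrite mulr0 oppr0 expR0 mulr1.
  have pi_gt0 : 0 < p i by rewrite lt_neqAle eq_sym pi_neq0 p_ge0.
  have qi_gt0 : 0 < q i by rewrite lt_neqAle eq_sym qi_neq0 q_ge0.
  (* Since t p_i = k_i, the exponential becomes the natural power (q_i / p_i)^(k_i). *)
  rewrite mulrA {1}/p mulrA divff ?gt_eqF // mul1r -mulrN expRM_natl.
  by rewrite expRN lnK ?posrE ?divr_gt0 // -exprMn invf_div divfK.
by rewrite ler_pM2r // ler_expR lerN2 ler_pM2l // lee_fin.
Qed.

(** * Method of types *)

Definition letter_count {t : nat} {I : finType} (s : 'I_t -> I) (i : I) : nat :=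
  #|[set j | s j == i]%SET|.

Lemma sum_letter_count {t : nat} {I : finType} (s : 'I_t -> I) :
  (\sum_i letter_count s i)%N = t.
Proof.
rewrite -[RHS]card_ord -sum1_card (partition_big s predT) //=.
by apply: eq_bigr => i _; rewrite sum1_card /letter_count cardsE.
Qed.

Lemma prod_letter_count (R : comNzRingType) (t : nat) (I : finType)
    (s : 'I_t -> I) (q : I -> R) :
  \prod_j q (s j) = \prod_i q i ^+ letter_count s i.
Proof.
rewrite (partition_big s predT) //=; apply: eq_bigr => i _.
rewrite /letter_count cardsE -prodr_const.
by apply: eq_bigr => j /eqP ->.
Qed.

Lemma sum_prod_simplex (R : realType) (t : nat) (I : finType) (q : I -> R) :
  simplex R I q -> \sum_(s : {ffun 'I_t -> I}) \prod_j q (s j) = 1.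
Proof.
move=> [_ q1]; rewrite -(bigA_distr_bigA (fun=> q)) /=.
by apply: big1 => j _; exact: q1.
Qed.

(* A sample of bad type is at least exp(t r) times likelier under its own type
   than under q, and each of the at most (t + 1)^|I| types is a distribution. *)
Lemma sanov_bound (R : realType) (t : nat) (I : finType) (q : I -> R) (r : R) :
  (0 < t)%N -> simplex R I q ->
  \sum_(s : {ffun 'I_t -> I} |
        ~~ (KL (fun i => t%:R^-1 * (letter_count s i)%:R)%R q <= r%:E)%E)
    \prod_j q (s j)
  <= (t + 1)%:R ^+ #|I| * expR (- (t%:R * r)).
Proof.
move=> t_gt0 [q_ge0 q1].
have tR_gt0 : 0 < t%:R :> R by rewrite ltr0n.
(* Counts lie between 0 and t, so types embed in the maps to ['I_t.+1]; this is the source of the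
   factor (t + 1)^|I|. *)
pose type (k : {ffun I -> 'I_t.+1}) i : R := t%:R^-1 * (k i)%:R.
have type_ge0 k i : 0 <= type k i by rewrite mulr_ge0 // invr_ge0 ler0n.
pose T := [pred k : {ffun I -> 'I_t.+1} | (\sum_i k i == t)%N].
have type1 k : T k -> simplex R I (type k).
  move=> /eqP kt; split=> //.
  by rewrite -mulr_sumr -natr_sum kt mulVf ?gt_eqF.
pose C := expR (- (t%:R * r)).
(* Each bad sample is charged to its own type. Adding the other types, and the good samples, only
   enlarges the bound and makes the two sums independent. *)
apply: (@le_trans _ _
    (\sum_(s : {ffun 'I_t -> I}) C * \sum_(k | T k) \prod_j type k (s j))).
  rewrite big_mkcond; apply: ler_sum => s _.
  have rhs_ge0 (k : {ffun I -> 'I_t.+1}) : 0 <= \prod_j type k (s j).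
    by apply: prodr_ge0.
  case: ifPn => [bad|_]; last first.
    by rewrite mulr_ge0 ?expR_ge0 ?sumr_ge0.
  pose k : {ffun I -> 'I_t.+1} := [ffun i => inord (letter_count s i)].
  have kE i : k i = letter_count s i :> nat.
    rewrite ffunE inordK // ltnS -[leqRHS](sum_letter_count s).
    by rewrite (bigD1 i) //= leq_addr.
  have Tk : T k.
    by rewrite /T /= (eq_bigr _ (fun i _ => kE i)) sum_letter_count.
  rewrite (bigD1 k) //= mulrDr -[leLHS]addr0 lerD //; last first.
    by rewrite mulr_ge0 ?expR_ge0 ?sumr_ge0.
  rewrite (prod_letter_count _ _ _ s q) (prod_letter_count _ _ _ s (type k)).
  under [X in _ <= C * X]eq_bigr => i _ do rewrite /type kE.
  by move: bad; rewrite KL_type_le // -ltNge => /ltW.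
rewrite -mulr_sumr exchange_big /= mulrC ler_wpM2r ?expR_ge0 //.
rewrite (eq_bigr (fun=> 1)) => [|k /type1]; last exact: sum_prod_simplex.
rewrite sumr_const -natrX ler_nat.
by rewrite (leq_trans (max_card _)) // card_ffun card_ord addn1.
Qed.

(** * Attainment of the inner maxima *)

(** In likelihood form the ball is cut out of the unit cube by closed conditions on continuous
    functions. Row vectors supply the topology. *)
Lemma compact_KL_ball (R : realType) (d t : nat) (k : 'I_d -> nat) (r : R) :
  (0 < t)%N ->
  compact [set u : 'rV[R]_d | simplex R 'I_d (u ord0) /\
    (KL (fun i => t%:R^-1 * (k i)%:R)%R (u ord0) <= r%:E)%E].
Proof.
move=> t_gt0.
have coord i : continuous (fun u : 'rV[R]_d => u ord0 i).
  exact: coord_continuous.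
have sum_cont : continuous (fun u : 'rV[R]_d => \sum_i u ord0 i).
  by apply: continuous_big => //; exact: add_continuous.
have prod_cont : continuous (fun u : 'rV[R]_d => \prod_i u ord0 i ^+ k i).
  apply: continuous_big => [|i _]; first exact: mul_continuous.
  move=> u; apply: (@continuous_comp _ _ _ (fun u : 'rV[R]_d => u ord0 i)
    (fun x : R => x ^+ k i)).
    exact: coord.
  exact: exprn_continuous.
pose box := [set u : 'rV[R]_d | forall i, `[0, 1]%classic (u ord0 i)].
have box_compact : compact box.
  apply: (@rV_compact R d (fun=> `[0 : R, 1]%classic)) => i.
  exact: segment_compact.
set C := expR (- (t%:R * r)) * \prod_i (t%:R^-1 * (k i)%:R) ^+ k i.
have -> : [set u : 'rV[R]_d | simplex R 'I_d (u ord0) /\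
      (KL (fun i => t%:R^-1 * (k i)%:R)%R (u ord0) <= r%:E)%E] =
    box `&`
    ((fun u => \sum_i u ord0 i) @^-1` [set y | y = 1] `&`
     (fun u => \prod_i u ord0 i ^+ k i) @^-1` [set y | C <= y]).
  apply/seteqP; split=> [u [[u_ge0 u1]]|u [u01 [u1 uC]]] /=.
    rewrite KL_type_le // => uC; split=> // i.
    rewrite /= in_itv /= u_ge0 -u1 (bigD1 i) //= lerDl.
    by rewrite sumr_ge0.
  have u_ge0 i : 0 <= u ord0 i
    by have /= := u01 i; rewrite in_itv /= => /andP[].
  by split; [split|rewrite KL_type_le].
apply: (subclosed_compact _ box_compact) => [|u []//].
apply: closedI; first by apply: compact_closed => //; exact: norm_hausdorff.
by apply: closedI; apply: preimage_closed => [u _|]; [exact: sum_cont|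
  exact: closed_eq|exact: prod_cont|exact: closed_ge].
Qed.

Lemma expect_le_maximum (R : realType) (d t : nat) (k : 'I_d -> nat) (r : R)
    (v q : 'I_d -> R) :
  (0 < t)%N -> simplex R 'I_d q ->
  (KL (fun i => t%:R^-1 * (k i)%:R)%R q <= r%:E)%E ->
  expect v q <= maximum [set expect v q | q in simplex R 'I_d `&`
    [set q | (KL (fun i => t%:R^-1 * (k i)%:R)%R q <= r%:E)%E]].
Proof.
move=> t_gt0 q_simplex q_KL; set A := [set _ | _ in _].
have A_q : A (expect v q) by exists q.
pose f (u : 'rV[R]_d) := expect v (u ord0).
have f_cont : continuous f.
  apply: continuous_big => [|i _]; first exact: add_continuous.
  by move=> u; apply: continuousM;
    [exact: coord_continuous|exact: cst_continuous].
have K0 : [set u : 'rV[R]_d | simplex R 'I_d (u ord0) /\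
    (KL (fun i => t%:R^-1 * (k i)%:R)%R (u ord0) <= r%:E)%E] !=set0.
  exists (\row_i q i) => /=.
  by rewrite (_ : (\row_i q i) ord0 = q) //; apply/funext => i; rewrite mxE.
have [c] := compact_EVT_max K0 (compact_KL_ball R d t k r t_gt0)
  (continuous_subspaceT f_cont).
rewrite inE => -[c_simplex c_KL] c_max.
have c_ub : (A `&` ubound A) (f c).
  split; first by exists (c ord0).
  move=> _ [q' [q'_simplex q'_KL] <-].
  have q'E : (\row_i q' i) ord0 = q' by apply/funext => i; rewrite mxE.
  have := c_max (\row_i q' i); rewrite /f q'E; apply.
  by rewrite inE /= q'E.
(* The maximizer [c] shows that [maximum] does not fall back on its default value 0. *)
have [_ ub] := xgetPex 0 (ex_intro _ _ c_ub).
exact: ub.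
Qed.

(** * Events determined by the data and their probabilities *)

(** Such an [E] is a finite union of cells of the partition generated by the [B i]. *)
Lemma finitely_determined_measurable (disp : measure_display)
    (T : measurableType disp) (I : finType) (B : I -> set T) (E : set T) :
  (forall i, measurable (B i)) ->
  (forall w w', (forall i, B i w <-> B i w') -> E w -> E w') ->
  measurable E.
Proof.
move=> B_meas E_det.
pose cell (b : {ffun I -> bool}) :=
  \bigcap_(i in [set: I]) (if b i then B i else ~` B i).
have -> : E = \bigcup_(b in [set b | exists2 w, E w & cell b w]) cell b.
  apply/seteqP; split=> [w Ew|w [b [w' Ew' w'b] wb]].
    pose b := [ffun i => `[< B i w >]].
    have wb : cell b w by move=> i _; rewrite ffunE; case: asboolP.
    by exists b => //; exists w.
  apply: E_det Ew' => i; have := w'b i Logic.I; have := wb i Logic.I.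
  by case: ifP.
apply: fin_bigcup_measurable => [|b _]; first exact: finite_finset.
apply: fin_bigcap_measurable => [|i _]; first exact: finite_finset.
by case: ifP => _; [|apply: measurableC].
Qed.

Section Sanov.
Context {disp : measure_display} {Omega : measurableType disp} {R : realType}.
Variable P : probability Omega R.
Context {k t : nat} (v q : 'I_k -> R) (c : 'I_t -> {RV P >-> R}).

Lemma measurable_RV_eq (X : {RV P >-> R}) (y : R) :
  measurable (X @^-1` [set y]).
Proof. by rewrite -[_ @^-1` _]setTI; exact: measurable_funP. Qed.

(** The intersection runs over a finite set of indices so as to match the form of
    [mutually_independent]. *)
Definition sample_event (s : 'I_t -> 'I_k) : set Omega :=
  \bigcap_(j in [set` [set: 'I_t]%SET]) (c j @^-1` [set v (s j)]).

Lemma sample_event_measurable s : measurable (sample_event s).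
Proof.
apply: fin_bigcap_measurable => [|j _]; first exact: finite_finset.
exact: measurable_RV_eq.
Qed.

Lemma sample_eventE s w : sample_event s w <-> forall j, c j w = v (s j).
Proof. by split=> [sw j|sw j _]; [apply: sw; rewrite /= inE|exact: sw]. Qed.

Lemma empirical_sample_event s w : injective v -> sample_event s w ->
  empirical v (fun j => c j w) = (fun i => t%:R^-1 * (letter_count s i)%:R).
Proof.
move=> v_inj /sample_eventE sw; apply/funext => i.
rewrite /empirical /letter_count.
by congr (_ * _%:R); apply: eq_card => j; rewrite !inE sw (inj_eq v_inj).
Qed.

Hypothesis c_iid : iid_samples v q c.

Lemma sample_event_prob s : P (sample_event s) = (\prod_j q (s j))%:E.
Proof.
have [c_ind c_law] := c_iid.
rewrite /sample_event (c_ind _ (fun j => [set v (s j)])) //.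
rewrite -prodEFin; apply: eq_big => [j|j _]; first by rewrite inE.
by rewrite -(c_law j) /pmf fineK // fin_num_measure //; exact: measurable_RV_eq.
Qed.

Lemma sample_event_bigcup_prob (Q : pred {ffun 'I_t -> 'I_k}) : injective v ->
  P (\bigcup_(s in [set` Q]) sample_event s) =
  (\sum_(s | Q s) \prod_j q (s j))%:E.
Proof.
move=> v_inj; rewrite measure_fin_bigcup.
- rewrite -(bigfs _ (index_enum_uniq _)) => [|s _]; last first.
    by rewrite mem_index_enum.
  by rewrite -sumEFin; apply: eq_bigr => s _; exact: sample_event_prob.
- exact: finite_finset.
- move=> s s' _ _ [w [/sample_eventE sw /sample_eventE s'w]].
  by apply/ffunP => j; apply: v_inj; rewrite -sw -s'w.
- by move=> s _; exact: sample_event_measurable.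
Qed.

Lemma sanov_probability (r : R) : (0 < t)%N -> injective v ->
  simplex R 'I_k q ->
  let bad := [set w | ~~ (KL (empirical v (fun j => c j w)) q <= r%:E)%E] in
  measurable bad /\
  (P bad <= ((t + 1)%:R ^+ k * expR (- (t%:R * r)))%:E)%E.
Proof.
move=> t_gt0 v_inj q_simplex bad.
have bad_meas : measurable bad.
  apply: (finitely_determined_measurable _ _ _
    (fun ji : 'I_t * 'I_k => c ji.1 @^-1` [set v ji.2])) => [ji|w w' ww'].
    exact: measurable_RV_eq.
  rewrite /bad /=; suff -> : empirical v (fun j => c j w) =
    empirical v (fun j => c j w') by [].
  apply/funext => i; rewrite /empirical.
  congr (_ * _%:R); apply: eq_card => j; rewrite !inE.
  by apply/eqP/eqP => /(ww' (j, i)).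
split=> //.
pose Q := [pred s : {ffun 'I_t -> 'I_k} |
  ~~ (KL (fun i => t%:R^-1 * (letter_count s i)%:R)%R q <= r%:E)%E].
pose U (Q : pred {ffun 'I_t -> 'I_k}) :=
  \bigcup_(s in [set` Q]) sample_event s.
have U_meas S : measurable (U S).
  apply: fin_bigcup_measurable => [|s _]; first exact: finite_finset.
  exact: sample_event_measurable.
(* Samples may leave the support, but only on a null set: the sample events are disjoint and their
   probabilities sum to 1. *)
have UC0 : P (~` U predT) = 0%E.
  rewrite probability_setC // sample_event_bigcup_prob //.
  by rewrite sum_prod_simplex // subee.
have bad_sub : bad `<=` U Q `|` ~` U predT.
  move=> w bad_w; have [[s _ sw]|] := pselect (U predT w); last by right.
  left; exists s => //; move: bad_w.
  by rewrite /bad /= (empirical_sample_event s w).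
apply: (@le_trans _ _ (P (U Q `|` ~` U predT))).
  by rewrite le_measure ?inE //; apply: measurableU => //; apply: measurableC.
have : (P (U Q `|` ~` U predT) <= P (U Q) + P (~` U predT))%E.
  by apply: measureU2 => //; exact: measurableC.
move/le_trans; apply.
rewrite UC0 adde0 sample_event_bigcup_prob // lee_fin.
by rewrite (le_trans (sanov_bound _ _ _ q r t_gt0 q_simplex)) // card_ord.
Qed.

End Sanov.

(** * Marginals, radii and the prediction rule *)

Section Marginals.
Context {R : realType} {n : nat} {d : 'I_n -> nat}.
Variable Q : {dffun forall a : 'I_n, 'I_(d a)} -> R.

Lemma marginal_simplex a : simplex R {dffun forall a : 'I_n, 'I_(d a)} Q ->
  simplex R 'I_(d a) (marginal Q a).
Proof.
move=> [Q_ge0 Q1]; split=> [i|]; first exact: sumr_ge0.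
rewrite -Q1 [RHS](partition_big
  (fun s : {dffun forall a : 'I_n, 'I_(d a)} => s a) predT) //.
Qed.

(** Linearity of expectation: grouping the outcomes by their [a]-th component leaves only the [a]-th
    marginal, whatever the dependence between components. *)
Lemma expected_loss_marginal z (x : 'cV[R]_n) :
  expected_loss z x Q = \sum_a expect (z a) (marginal Q a) * x a 0.
Proof.
rewrite /expected_loss {1}/expect.
under eq_bigr do rewrite mulr_sumr.
rewrite exchange_big; apply: eq_bigr => a _ /=.
rewrite (partition_big
  (fun s : {dffun forall a : 'I_n, 'I_(d a)} => s a) predT) //= mulr_suml.
apply: eq_bigr => i _; rewrite mulr_suml mulr_suml; apply: eq_bigr => s /eqP <-.
by rewrite mulrA.
Qed.

End Marginals.

(** The logarithm of T_a + 1 in the radius cancels the number of types, and -ln delta_a leaves the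
    share of component [a] in the union bound. *)
Lemma kl_radius_tail (R : realType) (n : nat) (d : 'I_n -> nat) (r : R)
    (delta : 'I_n -> R) (T : 'I_n -> nat) a :
  (0 < T a)%N -> 0 < delta a ->
  (T a + 1)%:R ^+ d a * expR (- ((T a)%:R * kl_radius d r delta T a)) =
  delta a * expR (- (r * (Tmin T)%:R)).
Proof.
move=> T_gt0 delta_gt0.
have TS_gt0 : 0 < (T a + 1)%:R :> R by rewrite ltr0n addn1.
rewrite /kl_radius mulrA divff ?pnatr_eq0 -?lt0n // mul1r.
rewrite !opprD opprK !expRD lnK ?posrE //.
rewrite [expR (- (_ * ln _))]expRN expRM_natl lnK ?posrE //.
rewrite !mulrA divff ?mul1r; first by rewrite mulrC.
by rewrite expf_neq0 // gt_eqF.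
Qed.

Lemma le_dr_rule (R : realType) (n : nat) (d : 'I_n -> nat)
    (z : forall a : 'I_n, 'I_(d a) -> R) (rad : 'I_n -> R) (x : 'cV[R]_n)
    (Q : {dffun forall a : 'I_n, 'I_(d a)} -> R) (T : 'I_n -> nat)
    (c : forall a, 'I_(T a) -> R) :
  simplex R {dffun forall a : 'I_n, 'I_(d a)} Q ->
  (forall a, (0 < T a)%N) -> (forall a, 0 <= x a 0) ->
  (forall a,
    (KL (empirical (z a) (c a)) (marginal Q a) <= (rad a)%:E)%E) ->
  expected_loss z x Q <= dr_rule z rad x (fun a => empirical (z a) (c a)).
Proof.
move=> Q_simplex T_gt0 x_ge0 near_Q; rewrite expected_loss_marginal.
apply: ler_sum => a _; rewrite ler_wpM2r //.
exact: (expect_le_maximum _ _ _ (fun i => #|[set j | c a j == z a i]%SET|)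
  _ _ _ (T_gt0 a) (marginal_simplex _ _ Q_simplex) (near_Q a)).
Qed.

(** * Union bound over the components *)

Section Disappointment.
Context {R : realType} {n : nat} {d : 'I_n -> nat}.
Variables (z : forall a : 'I_n, 'I_(d a) -> R) (r : R) (delta : 'I_n -> R).
Variables (x : 'cV[R]_n) (Q : {dffun forall a : 'I_n, 'I_(d a)} -> R).
Variable T : 'I_n -> nat.
Context {disp : measure_display} {Omega : measurableType disp}.
Variables (P : probability Omega R) (c : forall a, 'I_(T a) -> {RV P >-> R}).

Lemma disappointment_bound :
  (forall a, injective (z a)) -> (forall a, 0 < delta a) ->
  \sum_a delta a = 1 -> (forall a, 0 <= x a 0) ->
  simplex R {dffun forall a : 'I_n, 'I_(d a)} Q -> (forall a, (0 < T a)%N) ->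
  (forall a, iid_samples (z a) (marginal Q a) (c a)) ->
  (P [set w | (expected_loss z x Q >
       dr_rule z (kl_radius d r delta T) x
         (fun a => empirical (z a) (fun j => c a j w)))%R] <=
   (expR (- (r * (Tmin T)%:R)))%:E)%E.
Proof.
move=> z_inj delta_gt0 delta1 x_ge0 Q_simplex T_gt0 c_iid; set E := [set _ | _].
pose bad a := [set w | ~~ (KL (empirical (z a) (fun j => c a j w))
  (marginal Q a) <= (kl_radius d r delta T a)%:E)%E].
have sanov a := sanov_probability P _ _ _ (c_iid a)
  (kl_radius d r delta T a) (T_gt0 a) (z_inj a)
  (marginal_simplex _ a Q_simplex).
have E_meas : measurable E.
  (* The event depends only on which sample equals which support point; dependent pairs index these
     because both ranges vary with [a]. *)
  apply: (finitely_determined_measurable _ _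
    {a : 'I_n & 'I_(T a) * 'I_(d a)}%type
    (fun u => c (tag u) (tagged u).1 @^-1` [set z (tag u) (tagged u).2])).
    by move=> u; exact: measurable_RV_eq.
  move=> w w' ww'; rewrite /E /=.
  suff -> : (fun a => empirical (z a) (c a ^~ w))
    = (fun a => empirical (z a) (c a ^~ w')) by [].
  apply: functional_extensionality_dep => a; apply/funext => i.
  rewrite /empirical.
  congr (_ * _%:R); apply: eq_card => j; rewrite !inE.
  by apply/eqP/eqP => /(ww' (Tagged _ (j, i))).
have E_sub : E `<=` \bigcup_(a in [set` predT]) bad a.
  move=> w; apply: contraPP => w_good; apply/negP; rewrite -leNgt.
  apply: (le_dr_rule _ _ _ _ _ _ _ _ (fun a j => c a j w)) => // a.
  by apply: contrapT => /negP w_bad; apply: w_good; exists a.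
apply: (@le_trans _ _ (\sum_(a \in [set` predT]) P (bad a))%E).
  apply: content_sub_fsum => // a _; exact: (sanov a).1.
rewrite -(bigfs _ (index_enum_uniq _)) => [|a _]; last first.
  by rewrite mem_index_enum.
(* Writing 1 as the sum of the delta_a splits the bound into one share per component. *)
rewrite -[leRHS]mul1e -[X in (_ <= X%:E * _)%E]delta1 -EFinM mulr_suml -sumEFin.
apply: lee_sum => a _; rewrite -(kl_radius_tail _ _ d) //.
exact: (sanov a).2.
Qed.

End Disappointment.

(** * Passage to the limit superior *)

Lemma limsup_Tmin_le (R : realType) (n : nat) (g : ('I_n -> nat) -> \bar R)
    (l : \bar R) :
  (forall T, (forall a, (0 < T a)%N) -> (0 < Tmin T)%N -> (g T <= l)%E) ->
  (limsup_Tmin g <= l)%E.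
Proof.
(* The suprema run over shrinking sets, so they are nonincreasing in m and the limit exists. *)
move=> g_le; apply: lime_le.
  apply: ereal_nonincreasing_is_cvgn => m m' mm'; apply: ereal_sup_le.
  move=> _ [T [T_gt0 m'T] <-]; exists T => //; split=> //.
  exact: leq_trans m'T.
(* Starting at m = 1 makes [Tmin T] positive. *)
exists 1%N => // m /= m_gt0; apply: ge_ereal_sup => _ [T [T_gt0 mT] <-].
by apply: g_le => //; exact: leq_trans mT.
Qed.

Lemma scaled_lne_le (R : realType) (m : nat) (p : \bar R) (r : R) :
  (0 < m)%N -> (0 <= p)%E -> (p <= (expR (- (r * m%:R)))%:E)%E ->
  ((m%:R^-1)%:E * lne p <= (- r)%:E)%E.
Proof.
move=> m_gt0 p_ge0 p_le; have mR_gt0 : 0 < m%:R :> R by rewrite ltr0n.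
have -> : - r = m%:R^-1 * (- (r * m%:R)).
  by rewrite mulrN mulrC mulfK ?gt_eqF.
rewrite EFinM lee_wpmul2l ?lee_fin ?invr_ge0 ?ler0n //.
(* Comparing extended logarithms also covers p = 0. *)
rewrite -[leRHS]expeRK lee_lne //= in_itv /= ?p_ge0 ?leey //.
by rewrite lee_fin expR_ge0.
Qed.

Theorem theorem1 (R : realType) (n1 n2 : nat)
    (X : set 'cV[R]_(n1 + n2))
    (hX : linear_mixed_integer_set X)
    (X_nonempty : X !=set0)
    (X_n0 : ~ X 0)
    (X_bounded : exists u : 'cV[R]_(n1 + n2), (forall a, 0 <= u a 0) /\
       forall x, X x -> forall a, 0 <= x a 0 <= u a 0)
    (d : 'I_(n1 + n2) -> nat)
    (z : forall a : 'I_(n1 + n2), 'I_(d a) -> R)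
    (z_inj : forall a, injective (z a))
    (z_gt0 : forall a i, 0 < z a i)
    (r : R) (r_gt0 : 0 < r)
    (delta : 'I_(n1 + n2) -> R)
    (delta01 : forall a, 0 < delta a < 1)
    (delta_sum : \sum_a delta a = 1)
    (x : 'cV[R]_(n1 + n2)) (hx : X x)
    (Qstar : {dffun forall a : 'I_(n1 + n2), 'I_(d a)} -> R)
    (hQstar : simplex R {dffun forall a : 'I_(n1 + n2), 'I_(d a)} Qstar)
    (disp : measure_display)
    (Omega : ('I_(n1 + n2) -> nat) -> measurableType disp)
    (Pr : forall T : 'I_(n1 + n2) -> nat, probability (Omega T) R)
    (chat : forall (T : 'I_(n1 + n2) -> nat) (a : 'I_(n1 + n2)),
       'I_(T a) -> {RV (Pr T) >-> R})
    (chat_iid : forall T : 'I_(n1 + n2) -> nat, (forall a, (0 < T a)%N) ->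
       forall a, iid_samples (z a) (marginal Qstar a) (@chat T a)) :
  (limsup_Tmin (fun T : 'I_(n1 + n2) -> nat =>
     ((Tmin T)%:R^-1)%:E *
     lne (Pr T [set w | (expected_loss z x Qstar >
            dr_rule z (kl_radius d r delta T) x
              (fun a => empirical (z a) (fun j => @chat T a j w)))%R]))
   <= (- r)%:E)%E.
Proof.
have [u [_ u_bound]] := X_bounded.
have x_ge0 a : 0 <= x a 0 by have /andP[] := u_bound x hx a.
have delta_gt0 a : 0 < delta a by have /andP[] := delta01 a.
(* The exponential bound holds at every tuple of sizes, so the scaled logarithm is at most -r before
   any limit is taken. *)
apply: limsup_Tmin_le => T T_gt0 Tmin_gt0; apply: scaled_lne_le => //.
by apply: disappointment_bound => // a; exact: chat_iid.
Qed.
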